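(* Let $n>7$ be a positive integer. All $2$-element subsets of $\mathbb{Z}_n$ are index unstable if and only if $\gcd(n,210)=1$ (i.e., every prime factor of $n$ is greater than or equal to $11$).
   Context: $\mathbb{Z}_n=\{0,1,\ldots,n-1\}$ is the group of least nonnegative residues modulo $n$ under addition modulo $n$; sums and differences of elements and subsets are taken in this group, so $A-A=\{a-a' : a,a'\in A\}$, etc. Let $A$ be a non-empty subset of $\mathbb{Z}_n$. A subset $B\subseteq\mathbb{Z}_n$ is called a subfactor of $\mathbb{Z}_n$ relative to $A$ if $(A-A)\cap(B-B)=\{0\}$ and $(A-A)+B=\mathbb{Z}_n$. The lower subindex $|\mathbb{Z}_n:A|^-$ (resp. upper subindex $|\mathbb{Z}_n:A|^+$) is the minimum (resp. maximum) of $|B|$ over all subfactors $B$ of $\mathbb{Z}_n$ relative to $A$. The set $A$ is called index stable (in $\mathbb{Z}_n$) if $|\mathbb{Z}_n:A|^-=|\mathbb{Z}_n:A|^+$, and index unstable otherwise. *)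

(* Defs.v *)
From HB Require Import structures.
From mathcomp Require Import all_boot all_order all_algebra.
Set Implicit Arguments.
Unset Strict Implicit.
Unset Printing Implicit Defensive.

Import GRing.Theory.
Local Open Scope ring_scope.

Definition sumset (G : finZmodType) (A B : {set G}) : {set G} :=
  [set a + b | a in A, b in B].

Definition diffset (G : finZmodType) (A B : {set G}) : {set G} :=
  [set a - b | a in A, b in B].

Definition subfactor (G : finZmodType) (A B : {set G}) : bool :=
  (diffset A A :&: diffset B B == [set 0]) &&
  (sumset (diffset A A) B == [set: G]).

(* Every [#|B|] is at most [#|G|], so the initial value [#|G|] does not affect
   the minimum as soon as one subfactor exists, which is the case for every
   non-empty [A] (take a maximal [B] satisfying the first condition). *)
Definition lower_subindex (G : finZmodType) (A : {set G}) : nat :=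
  \big[minn/#|G|]_(B : {set G} | subfactor A B) #|B|.

Definition upper_subindex (G : finZmodType) (A : {set G}) : nat :=
  \max_(B : {set G} | subfactor A B) #|B|.

Definition index_stable (G : finZmodType) (A : {set G}) : bool :=
  lower_subindex A == upper_subindex A.

Definition index_unstable (G : finZmodType) (A : {set G}) : bool :=
  ~~ index_stable A.

(* Main.v *)
Require Import Defs.
From HB Require Import structures.
From mathcomp Require Import all_boot all_order all_algebra.

(** For [A = {a, a + d}], a subfactor is a maximal independent set of the graph
    joining [x] to [x + d], which is a disjoint union of cycles whose length is
    the order of [d].  On cycles of length 2, 3, 5, 7 all maximal independent
    sets have the same size, so taking [d = n / p] gives a stable set whenever
    [p] in {2, 3, 5, 7} divides [n].  If instead [gcd(n, 210) = 1], every
    non-zero [d] has order at least 11; extend [{0, 2d, 4d, 6d}] to a maximal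
    independent set and replace [2d, 4d] by [3d]: this is again a maximal
    independent set, with one element less. *)

Section TwoElementSets.

Import GRing.Theory.
Local Open Scope ring_scope.

Lemma lower_subindex_le (G : finZmodType) (A B : {set G}) :
  subfactor A B -> (lower_subindex A <= #|B|)%N.
Proof.
move=> sfB; rewrite /lower_subindex.
have : B \in index_enum {set G} by rewrite mem_index_enum.
elim: (index_enum _) => // C s IHs; rewrite inE big_cons => /orP[/eqP <-|/IHs leB].
  by rewrite sfB geq_minl.
by case: ifP => // _; rewrite geq_min leB orbT.
Qed.

Lemma upper_subindex_ge (G : finZmodType) (A B : {set G}) :
  subfactor A B -> (#|B| <= upper_subindex A)%N.
Proof. by move=> sfB; apply: (leq_bigmax_cond (F := fun C : {set G} => #|C|)). Qed.

Lemma index_unstable_ltn_card (G : finZmodType) (A B C : {set G}) :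
  subfactor A B -> subfactor A C -> (#|B| < #|C|)%N -> index_unstable A.
Proof.
move=> /lower_subindex_le leB /upper_subindex_ge leC ltBC.
by rewrite /index_unstable /index_stable neq_ltn (leq_ltn_trans leB (leq_trans ltBC leC)).
Qed.

Lemma index_stable_card_const (G : finZmodType) (A B : {set G}) :
  subfactor A B -> (forall C, subfactor A C -> #|C| = #|B|) -> index_stable A.
Proof.
move=> sfB cardE; rewrite /index_stable eqn_leq.
rewrite (leq_trans (lower_subindex_le _ _ _ sfB) (upper_subindex_ge _ _ _ sfB)) /=.
apply: (@leq_trans #|B|); first by apply/bigmax_leqP => C /cardE ->.
(* The default value [#|G|] of the minimum has to be at least [#|B|] as well. *)
rewrite /lower_subindex; apply: (big_ind (fun m => #|B| <= m)%N).
- exact: max_card.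
- by move=> x y lex ley; rewrite leq_min lex ley.
- by move=> C /cardE ->.
Qed.

Lemma diffset_pair (G : finZmodType) (a d x : G) :
  (x \in diffset [set a; a + d] [set a; a + d]) = [|| x == 0, x == d | x == - d].
Proof.
apply/imset2P/or3P.
  case=> u v /set2P[]-> /set2P[]-> ->.
  - by rewrite subrr; constructor 1.
  - by rewrite opprD addrA subrr add0r; constructor 3.
  - by rewrite [a + d]addrC addrK; constructor 2.
  - by rewrite subrr; constructor 1.
case=> /eqP->.
- by exists a a; rewrite ?set21 // subrr.
- by exists (a + d) a; rewrite ?set21 ?set22 // [a + d]addrC addrK.
- by exists a (a + d); rewrite ?set21 ?set22 // opprD addrA subrr add0r.
Qed.

(** The differences of the pair are [0], [d] and [- d], so the two conditions say that [B] is
    independent and dominating in the graph joining [x] to [x + d]. *)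
Lemma subfactor_pairP (G : finZmodType) (a d : G) (B : {set G}) :
  d != 0 ->
  reflect ((forall x, x \in B -> x + d \notin B) /\
           (forall x, [|| x \in B, x + d \in B | x - d \in B]))
          (subfactor [set a; a + d] B).
Proof.
move=> d0; apply: (iffP andP) => [[/eqP indep /eqP dom] | [indep dom]].
  split=> x.
    move=> xB; apply/negP => xdB; case/negP: d0; rewrite -in_set1 -indep inE.
    rewrite diffset_pair eqxx orbT; apply/imset2P; exists (x + d) x => //.
    by rewrite addrAC subrr add0r.
  have /imset2P[u y] : x \in sumset (diffset [set a; a + d] [set a; a + d]) B.
    by rewrite dom inE.
  rewrite diffset_pair => /or3P[]/eqP-> yB ->.
  - by rewrite add0r yB.
  - by rewrite [d + y]addrC addrK yB !orbT.
  - by rewrite addrAC addNr add0r yB orbT.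
split; apply/eqP/setP => x.
  rewrite !inE diffset_pair; apply/andP/eqP => [[]|->].
    case/or3P => /eqP-> // /imset2P[y z yB zB].
      move=> dE; have := indep z zB.
      by rewrite dE addrC subrK yB.
    move=> dE; have := indep y yB.
    by rewrite -(opprK d) dE opprB addrC subrK zB.
  rewrite eqxx; split=> //; apply/imset2P.
  (* Domination of [0] makes [B] non-empty, hence [0] lies in [B - B]. *)
  case/or3P: (dom 0) => zB; [exists 0 0 | exists (0 + d) (0 + d) |
    exists (0 - d) (0 - d)] => //; by rewrite subrr.
rewrite inE; apply/imset2P.
case/or3P: (dom x) => xB.
- by exists 0 x; rewrite ?diffset_pair ?eqxx ?add0r.
- by exists (- d) (x + d); rewrite ?diffset_pair ?eqxx ?orbT // addrC addrK.
- by exists d (x - d); rewrite ?diffset_pair ?eqxx ?orbT // addrC subrK.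
Qed.

(** An inclusion-maximal independent set is dominating: an undominated point could be added, as
    [d != 0] keeps it from being its own neighbour. *)
Lemma subfactor_pair_exists (G : finZmodType) (a d : G) (B0 : {set G}) :
  d != 0 -> (forall x, x \in B0 -> x + d \notin B0) ->
  exists2 B : {set G}, subfactor [set a; a + d] B & B0 \subset B.
Proof.
move=> d0 indep0.
pose P (B : {set G}) := [forall x in B, x + d \notin B].
have PB0 : P B0 by apply/forall_inP.
have [B /maxsetP[/forall_inP indep maxB] subB] := maxset_exists PB0.
exists B => //; apply/subfactor_pairP => //; split=> // x.
apply/negPn/negP; rewrite !negb_or => /and3P[xB xdB xNdB].
case/negP: xB; rewrite -(maxB (x |: B)) ?setU11 ?subsetUr //.
apply/forall_inP => y; rewrite !inE => /predU1P[->|yB].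
  by rewrite negb_or xdB andbT -subr_eq0 [x + d]addrC addrK.
rewrite negb_or indep // andbT; apply: contraNneq xNdB => <-.
by rewrite addrK.
Qed.

(** The window runs once around a cycle of length [p], where consecutive points of [B] are 2 or 3
    steps apart. As 2 = 2, 3 = 3, 5 = 2 + 3 and 7 = 2 + 2 + 3 are the only such splittings up to
    order, the number of points is [p./2]. *)
Lemma subfactor_pair_window_sum (G : finZmodType) (a d : G) (B : {set G}) p x :
  d != 0 -> d *+ p = 0 -> p \in [:: 2; 3; 5; 7]%N ->
  subfactor [set a; a + d] B ->
  (\sum_(i < p) ((x + d *+ i)%R \in B) = p./2)%N.
Proof.
move=> d0 pd0 pE /(subfactor_pairP _ _ _ _ d0)[indep dom].
pose f i := x + d *+ i \in B.
have fp i : f (i + p)%N = f i by rewrite /f mulrnDr pd0 addr0.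
have find i : ~~ (f i && f i.+1).
  by apply/negP => /andP[/indep]; rewrite /f mulrSr addrA => /negPf->.
have fdom i : [|| f i, f i.+1 | f i.+2].
  have xi : x + d *+ i.+1 - d = x + d *+ i by rewrite mulrSr addrA addrK.
  have xi2 : x + d *+ i.+1 + d = x + d *+ i.+2 by rewrite -addrA -mulrSr.
  by have := dom (x + d *+ i.+1); rewrite xi xi2 orbA orbC.
under eq_bigr => i _ do rewrite -/(f i).
(* The constraints starting at 0, ..., 6 cover the cycle even for [p = 7]; they involve only [f 0],
   ..., [f 8], so a finite check remains. *)
have := (find 0, fdom 0, fp 0, fp 1)%N.
move: pE (find 1%N) (find 2%N) (find 3%N) (find 4%N) (find 5%N) (find 6%N).
move: (fdom 1%N) (fdom 2%N) (fdom 3%N) (fdom 4%N) (fdom 5%N) (fdom 6%N).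
rewrite !inE => + + + + + + /or4P[]/eqP pE; move: fp; rewrite pE => _;
  rewrite !big_ord_recr big_ord0 /= ?add0n ?add1n.
all: move=> + + + + + + + + + + + + [[[]]]; rewrite /addn /=.
all: move: (f 0) (f 1) (f 2) (f 3) (f 4) (f 5) (f 6) (f 7) (f 8).
all: by do 9 case.
Qed.

(** Double counting of the pairs [(x, i)] with [x + d *+ i] in [B]: each [x] contributes [p./2], and
    each [i] contributes [#|B|] because translation is a bijection. *)
Lemma subfactor_pair_card (G : finZmodType) (a d : G) (B : {set G}) p :
  d != 0 -> d *+ p = 0 -> p \in [:: 2; 3; 5; 7]%N ->
  subfactor [set a; a + d] B -> (#|B| * p = #|G| * p./2)%N.
Proof.
move=> d0 pd0 pE sfB.
have <- : (\sum_(x : G) \sum_(i < p) ((x + d *+ i)%R \in B) = #|G| * p./2)%N.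
  under eq_bigr => x _ do rewrite (subfactor_pair_window_sum _ _ _ _ _ x d0 pd0 pE sfB).
  by rewrite sum_nat_const.
rewrite exchange_big /=.
under eq_bigr => i _.
  rewrite -(reindex_inj (F := fun x => (x \in B) : nat) (P := predT) (addIr (d *+ i))) /=.
  rewrite -big_mkcond /= sum1_card.
  over.
by rewrite sum_nat_const card_ord mulnC.
Qed.

Lemma index_stable_pair (G : finZmodType) (a d : G) p :
  d != 0 -> d *+ p = 0 -> p \in [:: 2; 3; 5; 7]%N ->
  index_stable [set a; a + d].
Proof.
move=> d0 pd0 pE.
have [|B sfB _] := subfactor_pair_exists G a d set0 d0; first by move=> x; rewrite inE.
apply: (index_stable_card_const _ _ B) => // C sfC; apply/eqP.
have p0 : (0 < p)%N by move: pE; rewrite !inE => /or4P[]/eqP->.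
rewrite -(eqn_pmul2r p0).
by rewrite !(subfactor_pair_card _ a d _ p).
Qed.

Lemma index_unstable_pair (G : finZmodType) (a d : G) :
  (forall k, (0 < k < 8)%N -> d *+ k != 0) -> index_unstable [set a; a + d].
Proof.
move=> dk.
have d0 : d != 0 by rewrite -[d]mulr1n dk.
have inj i j : (i < 8)%N -> (j < 8)%N -> (d *+ i == d *+ j) = (i == j).
  have neq k l : (k < l < 8)%N -> d *+ k != d *+ l.
    case/andP=> kl l8; rewrite eq_sym -subr_eq0 -mulrnBr 1?ltnW // dk // subn_gt0 kl /=.
    exact: leq_ltn_trans (leq_subr _ _) l8.
  move=> i8 j8; case: (ltngtP i j) => [ij|ji|->]; last by rewrite eqxx.
    by apply/negbTE/neq; rewrite ij.
  by rewrite eq_sym; apply/negbTE/neq; rewrite ji.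
(* Independence of the four points includes that [6d] and [0] are not adjacent, which is
   [7d != 0]. *)
have [|B sfB /subsetP sB] :=
    subfactor_pair_exists G a d [set d *+ 0; d *+ 2; d *+ 4; d *+ 6] d0.
  by move=> x; rewrite !inE -!orbA => /or4P[]/eqP->; rewrite -mulrSr !inj.
have [B0 B2 B4 B6] : [/\ d *+ 0 \in B, d *+ 2 \in B, d *+ 4 \in B & d *+ 6 \in B].
  by split; apply: sB; rewrite !inE eqxx ?orbT.
have [indep dom] := subfactor_pairP _ _ _ _ d0 sfB.
have B3 : d *+ 3 \notin B by rewrite mulrSr indep.
pose C := d *+ 3 |: (B :\ d *+ 2 :\ d *+ 4).
have [C0 C3 C6] : [/\ d *+ 0 \in C, d *+ 3 \in C & d *+ 6 \in C].
  by rewrite !inE !inj // B0 B6.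
have BC y : y \in B -> [\/ y = d *+ 2, y = d *+ 4 | y \in C].
  move=> yB; rewrite !inE yB andbT.
  case: (eqVneq y (d *+ 2)) => [->|_]; first by constructor 1.
  case: (eqVneq y (d *+ 4)) => [->|_]; first by constructor 2.
  by constructor 3; rewrite orbT.
apply: (index_unstable_ltn_card _ _ C B) => //; last first.
  rewrite (cardsD1 (d *+ 2) B) B2 (cardsD1 (d *+ 4) (B :\ _)) !inE B4 inj //=.
  by rewrite cardsU1 !inE (negPf B3) !andbF.
apply/subfactor_pairP => //; split=> x.
  (* Only [3d] is new, and its neighbours [2d] and [4d] have been removed. *)
  rewrite {1}/C !inE => /predU1P[->|/and3P[_ x2 xB]].
    by rewrite -mulrSr !inj.
  rewrite (negPf (indep _ xB)) !andbF orbF mulrSr.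
  by rewrite (inj_eq (addIr d)).
(* Only points dominated in [B] by [2d] or [4d] need care: [d] is now dominated by [0], [5d] by
   [6d], and [2d], [3d], [4d] by [3d]. *)
case/or3P: (dom x) => /BC[xE|xE|->]; rewrite ?orbT //.
- by rewrite xE -mulrSr C3 orbT.
- by rewrite xE [in x in x - d]mulrSr addrK C3 !orbT.
- have -> : x - d = d *+ 0 by apply: (addIr d); apply: (addIr d); rewrite subrK xE -!mulrSr.
  by rewrite C0 !orbT.
- have -> : x = d *+ 3 by apply: (addIr d); rewrite xE -mulrSr.
  by rewrite C3.
- have -> : x = d *+ 3 by rewrite -(subrK d x) xE -mulrSr.
  by rewrite C3.
- have -> : x + d = d *+ 6 by rewrite -(subrK d x) xE -!mulrSr.
  by rewrite C6 orbT.
Qed.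

End TwoElementSets.

Lemma prime_dvd_210 (n : nat) :
  gcdn n 210 != 1 -> exists2 p, p \in [:: 2; 3; 5; 7] & p %| n.
Proof.
move=> g1; exists (pdiv (gcdn n 210)); last first.
  by apply: dvdn_trans (pdiv_dvd _) (dvdn_gcdl _ _).
have pp : prime (pdiv (gcdn n 210)).
  by apply: pdiv_prime; rewrite ltn_neqAle eq_sym g1 gcdn_gt0 orbT.
have := pdiv_dvd (gcdn n 210); rewrite dvdn_gcd => /andP[_].
rewrite (_ : 210 = 2 * (3 * (5 * 7))) // !Euclid_dvdM // !dvdn_prime2 //.
by rewrite !inE.
Qed.

(** The primes below 11 are exactly the prime factors of 210. *)
Lemma coprime210P (n : nat) :
  gcdn n 210 = 1 <-> (forall p : nat, prime p -> p %| n -> 11 <= p).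
Proof.
split=> [g1 p pp pn | hp].
  rewrite leqNgt; apply/negP => p11.
  suff p210 : p %| 210.
    by have := dvdn_gcd p n 210; rewrite g1 pn p210 dvdn1 => /eqP p1; rewrite p1 in pp.
  by move: p p11 pp {pn}; do 11 (case=> //).
apply/eqP/negPn/negP => /prime_dvd_210[p pE pn].
have := hp p _ pn.
by move: pE; rewrite !inE => /or4P[]/eqP-> /(_ isT).
Qed.

Theorem theorem2p12 (n : nat) (hn : 7 < n) :
  ((forall A : {set 'Z_n}, #|A| = 2 -> index_unstable A) <-> gcdn n 210 = 1)
  /\ (gcdn n 210 = 1 <-> (forall p : nat, prime p -> p %| n -> 11 <= p)).
Proof.
(* ['Z_n] consists of the residues modulo [n] only when [1 < n]. *)
have n1 : 1 < n := leq_trans (isT : 1 < 8) hn.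
split; last exact: coprime210P.
split=> [unst | cop A /eqP/cards2P[a [b [ab ->]]]].
  apply/eqP/negPn/negP => /prime_dvd_210[p pE pn].
  (* The class of [n / p] has order [p], so the pair [0], [d] is stable. *)
  pose d : 'Z_n := ((n %/ p)%:R)%R.
  have p1 : 1 < p by move: pE; rewrite !inE => /or4P[]/eqP->.
  have dE : (d : nat) = n %/ p.
    by rewrite val_Zp_nat // modn_small // ltn_Pdiv // ltnW.
  have d0 : d != 0%R.
    apply/eqP => d0; move: dE; rewrite d0 => /esym/eqP.
    by rewrite -leqn0 leqNgt divn_gt0 ?(ltnW p1) // dvdn_leq // ltnW.
  have pd0 : (d *+ p = 0)%R.
    by rewrite /d -GRing.mulrnA divnK // pchar_Zp.
  have := index_stable_pair _ 0%R d p d0 pd0 pE.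
  by apply/negP; apply: unst; rewrite cards2 GRing.add0r eq_sym d0.
have -> : b = (a + (b - a))%R by rewrite GRing.addrC GRing.subrK.
apply: index_unstable_pair => k /andP[k0 k8].
have ku : (k%:R : 'Z_n)%R \is a GRing.unit.
  rewrite unitZpE //.
  (* The square is taken because of [k = 4], which divides [210 * 210] but not 210. *)
  have : coprime n (210 * 210) by rewrite coprimeMr /coprime cop.
  by apply: coprime_dvdr; move: k k0 k8; do 8 (case=> //).
(* As [k] is invertible, [k (b - a) = 0] would force [a = b]. *)
rewrite -GRing.mulr_natr -(GRing.mul0r (k%:R)%R) (inj_eq (GRing.mulIr ku)).
by rewrite GRing.subr_eq0 eq_sym.
Qed.
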